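(* Let $\delta\in(0,1)$. Consider Bernoulli bandit models with $K$ arms. Whatever the sampling rule, using Chernoff's stopping rule $\tau_\delta$ with threshold $$\beta(t,\delta)=\log\left(\frac{2t(K-1)}{\delta}\right)$$ ensures that for all $\boldsymbol\mu\in\mathcal S$, $\ \mathbb P_{\boldsymbol\mu}\left(\tau_\delta<\infty,\ \hat a_{\tau_\delta}\ne a^*\right)\le\delta$.
   Context: Let $K\ge2$, $\mathcal A=\{1,\dots,K\}$. $\mathcal S$ is the set of $\boldsymbol\mu\in(0,1)^K$ with a unique maximal coordinate, whose index is $a^*=a^*(\boldsymbol\mu)$. Under $\mathbb P_{\boldsymbol\mu}$, at each time $t=1,2,\dots$ an arm $A_t\in\mathcal A$ is chosen and a new independent reward $X_t\in\{0,1\}$ is drawn from the Bernoulli distribution with mean $\mu_{A_t}$; $\mathcal F_t=\sigma(X_1,\dots,X_t)$. A sampling rule is a sequence $(A_t)$ with $A_t$ being $\mathcal F_{t-1}$-measurable. $N_a(t)$ is the number of draws of arm $a$ up to time $t$, $\hat\mu_a(t)=N_a(t)^{-1}\sum_{s\le t}X_s\mathbf 1\{A_s=a\}$, and $\underline X^a_{N_a(t)}=(X_s:A_s=a,\ s\le t)$ is the vector of observations of arm $a$ up to time $t$. For $\mu\in[0,1]$, $p_\mu(z_1,\dots,z_n)=\prod_{k=1}^n\mu^{z_k}(1-\mu)^{1-z_k}$ (with $0^0=1$, and value $1$ for an empty vector). For $a\neq b$ in $\mathcal A$, the Generalized Likelihood Ratio statistic is $$Z_{a,b}(t)=\log\frac{\max_{\mu_a'\ge\mu_b'}p_{\mu_a'}(\underline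 X^a_{N_a(t)})\,p_{\mu_b'}(\underline X^b_{N_b(t)})}{\max_{\mu_a'\le\mu_b'}p_{\mu_a'}(\underline X^a_{N_a(t)})\,p_{\mu_b'}(\underline X^b_{N_b(t)})},$$ the maxima being over $\mu_a',\mu_b'\in[0,1]$. Chernoff's stopping rule with threshold $\beta(t,\delta)$ is $$\tau_\delta=\inf\Big\{t\ge1:\ \max_{a\in\mathcal A}\min_{b\in\mathcal A\setminus\{a\}}Z_{a,b}(t)>\beta(t,\delta)\Big\},$$ and the decision rule is $\hat a_{\tau_\delta}=\operatorname{argmax}_{a\in\mathcal A}\hat\mu_a(\tau_\delta)$. *)

(* Defs.v *)
(* MathComp-Analysis: the reals are an arbitrary [R : realType]. *)
From HB Require Import structures.
From mathcomp Require Export all_boot all_order all_algebra.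
From mathcomp Require Export all_classical all_reals all_analysis.

Set Implicit Arguments.
Unset Strict Implicit.
Unset Printing Implicit Defensive.

Import Order.TTheory GRing.Theory Num.Theory.
Local Open Scope classical_set_scope.
Local Open Scope ring_scope.

(* Arms are numbered 0, ..., K-1.  Time starts at t = 1: the values [A 0] and
   [X 0] of a sampling rule and of a reward process are never used.
   The reward [true] is 1 and [false] is 0. *)

Definition is_argmax (R : realType) (K : nat) (v : 'I_K -> R) (a : 'I_K)
    : Prop :=
  forall b, v b <= v a.

Definition calS (R : realType) (K : nat) : set ('I_K -> R) :=
  [set mu | (forall a, 0 < mu a < 1) /\ exists! a, is_argmax mu a].

(* F_t = sigma(X_1, ..., X_t) *)
Definition filtration (d : measure_display) (T : measurableType d)
    (X : nat -> {mfun T >-> bool}) (t : nat) : set (set T) :=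
  <<s \bigcup_(s in [set s : nat | (1 <= s <= t)%N])
        preimage_set_system setT (X s) measurable >>.

(* A map into the finite set of arms is measurable as soon as its fibres are. *)
Definition sampling_rule (d : measure_display) (T : measurableType d) (K : nat)
    (X : nat -> {mfun T >-> bool}) (A : nat -> T -> 'I_K) : Prop :=
  forall t, (1 <= t)%N ->
    forall a, filtration X t.-1 (A t @^-1` [set a]).

(* Given the past and given that arm a is chosen at time t, the reward X_t is
   independent of the past and has law Bernoulli(mu_a); equivalently,
   P(X_t = 1 | F_(t-1)) = mu_(A_t) almost surely. *)
Definition bandit_model (d : measure_display) (T : measurableType d)
    (R : realType) (K : nat) (P : probability T R) (mu : 'I_K -> R)
    (X : nat -> {mfun T >-> bool}) (A : nat -> T -> 'I_K) : Prop :=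
  forall t, (1 <= t)%N ->
    forall (a : 'I_K) (E : set T) (B : set bool), filtration X t.-1 E ->
      P (E `&` A t @^-1` [set a] `&` X t @^-1` B) =
      (P (E `&` A t @^-1` [set a]) * bernoulli_prob (mu a) B)%E.

Definition draws (K : nat) (A : nat -> 'I_K) (a : 'I_K) (t : nat) : nat :=
  (\sum_(1 <= s < t.+1) (A s == a))%N.

Definition emp_mean (R : realType) (K : nat) (X : nat -> bool)
    (A : nat -> 'I_K) (t : nat) (a : 'I_K) : R :=
  (draws A a t)%:R^-1 * \sum_(1 <= s < t.+1) (X s)%:R * (A s == a)%:R.

Definition obs (K : nat) (X : nat -> bool) (A : nat -> 'I_K) (a : 'I_K)
    (t : nat) : seq bool :=
  [seq X s | s <- iota 1 t & A s == a].

Definition lik (R : realType) (m : R) (z : seq bool) : R :=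
  \prod_(b <- z) (m ^+ b * (1 - m) ^+ (1 - b)).

(* The constraint sets C used below are compact and nonempty in [0,1]^2, so this
   supremum of a continuous function is a maximum; it is positive, since
   (1/2, 1/2) satisfies both constraints. *)
Definition max_lik (R : realType) (C : rel R) (za zb : seq bool) : R :=
  sup [set lik m.1 za * lik m.2 zb | m in
        [set m : R * R | [&& 0 <= m.1 <= 1, 0 <= m.2 <= 1 & C m.1 m.2]]].

Definition glr (R : realType) (K : nat) (X : nat -> bool) (A : nat -> 'I_K)
    (a b : 'I_K) (t : nat) : R :=
  ln (max_lik (fun x y : R => x >= y) (obs X A a t) (obs X A b t) /
      max_lik (fun x y : R => x <= y) (obs X A a t) (obs X A b t)).

(* The neutral elements -oo and +oo are never attained when K >= 2. *)
Definition glr_maxmin (R : realType) (K : nat) (X : nat -> bool)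
    (A : nat -> 'I_K) (t : nat) : \bar R :=
  \big[maxe/-oo%E]_(a < K) \big[mine/+oo%E]_(b < K | b != a)
    (glr R X A a b t)%:E.

(* [None] stands for an infinite infimum. *)
Definition first_time (p : pred nat) : option nat :=
  match pselect (exists t, p t) with
  | left ex => Some (ex_minn ex)
  | right _ => None
  end.

Definition chernoff_time (R : realType) (K : nat) (beta : nat -> R)
    (X : nat -> bool) (A : nat -> 'I_K) : option nat :=
  first_time (fun t => (1 <= t)%N && ((beta t)%:E < glr_maxmin R X A t)%E).

(* [ahat] recommends, on every path that stops, an arm of largest empirical mean
   at the stopping time; its value is unconstrained on the other paths.  Where
   the threshold is nonnegative, all arms have been drawn at the stopping time
   and the maximizer is unique, so neither the value of [emp_mean] on an undrawn
   arm nor tie-breaking matters. *)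
Definition decision_rule (d : measure_display) (T : measurableType d)
    (R : realType) (K : nat) (X : nat -> {mfun T >-> bool})
    (A : nat -> T -> 'I_K) (tau : T -> option nat) (ahat : T -> 'I_K) : Prop :=
  forall w t, tau w = Some t ->
    is_argmax (emp_mean R (X^~ w) (A^~ w) t) (ahat w).

(* Main.v *)
Require Import Defs.
From mathcomp Require Import ring lra.

(** Let b be a suboptimal arm and astar the best one.  At the stopping time
    some arm beats every other arm in the likelihood ratio test by a positive
    margin, and a positive statistic Z_{a,b} forces the empirical mean of a to
    exceed that of b; so the recommended arm is the winner of all the tests
    ([stops_winner]).  A wrong recommendation b therefore means that
    Z_{b,astar} crossed the threshold at some time, and by a union bound it is
    enough that each crossing has probability at most eps = delta / (K - 1),
    the threshold being log (2t / eps) ([glr_crossing]).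

    The true parameters satisfy the constraint mu_b <= mu_astar of the
    denominator of the likelihood ratio.  Hence a crossing at time t says that
    the true likelihood of the observations of the two arms is smaller, by a
    factor eps / (2t), than a maximized likelihood.  Up to a factor
    2 * sqrt n, the maximized likelihood of n >= 1 Bernoulli observations is
    at most their Krichevsky-Trofimov probability, the mixture of Bernoulli
    likelihoods under the Beta(1/2, 1/2) prior ([lik_le_kt]).  For two arms
    the two factors multiply to 4 sqrt (n_a n_b) <= 2 (n_a + n_b) <= 2t, which
    is exactly the 2t of the threshold: at a crossing, eps times the product of
    the two ratios Krichevsky-Trofimov / true likelihood is at least 1.

    Whatever the sampling rule, this product of ratios is a nonnegative
    martingale starting at 1, because the mixture is a probability on
    sequences: the probabilities of the two one-letter extensions of a sequence
    add up to its own ([ktseq_rcons]).  Ville's maximal inequality ([ville])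
    bounds the probability that eps times it ever reaches 1 by eps.

    Everything is expressed on the history of a path, the finite sequence of
    (arm, reward) pairs: histories range over a countable set, which settles
    measurability and makes Ville's inequality an induction on the tree of
    histories. *)

Set Implicit Arguments.
Unset Strict Implicit.
Unset Printing Implicit Defensive.

Import Order.TTheory GRing.Theory Num.Theory.
Import numFieldNormedType.Exports.
Local Open Scope classical_set_scope.
Local Open Scope ring_scope.

(** * Two logarithmic inequalities around a midpoint *)

Section logarithm.
Variable R : realType.
Implicit Types (v x : R) (k m n : nat).

Lemma ge0_of_derive_ge0 (f df : R -> R) v : 0 <= v -> f 0 = 0 ->
  (forall x, 0 <= x <= v -> is_derive x 1 f (df x)) ->
  (forall x, 0 <= x <= v -> 0 <= df x) -> 0 <= f v.
Proof.
move=> v0 f0 fd d0.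
have [|| c] := @MVT_segment R f df _ _ v0.
- move=> x; rewrite in_itv /= => /andP[/ltW h1 /ltW h2].
  by apply: fd; rewrite h1 h2.
- apply: derivable_within_continuous => x; rewrite in_itv /= => xv.
  by have [] := fd x xv.
- rewrite in_itv /= f0 subr0 => /d0 c0 ->.
  by rewrite mulr_ge0// subr0.
Qed.

Lemma is_derive_ln1D x : -1 < x ->
  is_derive x 1 (fun v : R => ln (1 + v)) (1 + x)^-1.
Proof.
move=> x1; have h : 0 < 1 + x by lra.
have dl := is_derive1_ln h.
have -> : (1 + x)^-1 = (1 + x)^-1 * (0 + 1) by rewrite add0r mulr1.
exact: (@is_derive1_comp R (@ln R) (fun v => 1 + v) x _ _ dl
  (@is_deriveD _ _ _ _ _ _ _ _ _ _ _)).
Qed.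

Lemma is_derive_ln1B x : x < 1 ->
  is_derive x 1 (fun v : R => ln (1 - v)) (- (1 - x)^-1).
Proof.
move=> x1; have h : 0 < 1 - x by lra.
have dl := is_derive1_ln h.
have -> : - (1 - x)^-1 = (1 - x)^-1 * (0 - 1) by rewrite sub0r mulrN1.
exact: (@is_derive1_comp R (@ln R) (fun v => 1 - v) x _ _ dl
  (@is_deriveB _ _ _ _ _ _ _ _ _ _ _)).
Qed.

(** With v = 1 / (2a + 1), so that (1 + v) / (1 - v) = (a + 1) / a: the integral
    of 1 / x over [a, a + 1] is at least its midpoint value, by convexity. *)
Lemma ln_ratio_ge v : 0 <= v < 1 -> 2 * v <= ln (1 + v) - ln (1 - v).
Proof.
case/andP=> v0 v1; rewrite -subr_ge0.
pose f x : R := ln (1 + x) - ln (1 - x) - 2 * x.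
pose df x : R := (1 + x)^-1 + (1 - x)^-1 - 2.
rewrite -[X in 0 <= X]/(f v).
apply: (@ge0_of_derive_ge0 f df v v0) => [|x|x]; rewrite /f /df.
- by rewrite addr0 subr0 ln1; ring.
- move=> /andP[x0 xv].
  have d1 := @is_derive_ln1D x ltac:(lra).
  have d2 := @is_derive_ln1B x ltac:(lra).
  by apply: is_derive_eq; rewrite opprK /GRing.scale /= mulr1.
- move=> /andP[x0 xv].
  have -> : (1 + x)^-1 + (1 - x)^-1 - 2 = 2 * x ^+ 2 / ((1 + x) * (1 - x)).
    by field; apply/andP; split; rewrite gt_eqF//; lra.
  by rewrite divr_ge0 ?mulr_ge0 ?sqr_ge0//; lra.
Qed.

(** With the same v, and up to scaling: the integral of ln over [a, a + 1] is at
    most ln (a + 1 / 2), by concavity. *)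
Lemma xlnx_midpoint v : 0 <= v < 1 ->
  (1 + v) * ln (1 + v) - (1 - v) * ln (1 - v) <= 2 * v.
Proof.
case/andP=> v0 v1; rewrite -subr_ge0.
pose f x : R := 2 * x - ((1 + x) * ln (1 + x) - (1 - x) * ln (1 - x)).
pose df x : R := - (ln (1 + x) + ln (1 - x)).
rewrite -[X in 0 <= X]/(f v).
apply: (@ge0_of_derive_ge0 f df v v0) => [|x|x]; rewrite /f /df.
- by rewrite addr0 subr0 ln1; ring.
- move=> /andP[x0 xv].
  have d1 := @is_derive_ln1D x ltac:(lra).
  have d2 := @is_derive_ln1B x ltac:(lra).
  have a1 : is_derive x 1 (fun v : R => 1 + v) 1.
    by apply: is_derive_eq; rewrite /GRing.scale /=; ring.
  have a2 : is_derive x 1 (fun v : R => 1 - v) (-1).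
    by apply: is_derive_eq; rewrite /GRing.scale /=; ring.
  have a3 : is_derive x 1 (fun v : R => 2 * v) 2.
    by apply: is_derive_eq; rewrite /GRing.scale /=; ring.
  have m1 := @is_deriveM _ _ _ _ _ _ _ _ a1 d1.
  have m2 := @is_deriveM _ _ _ _ _ _ _ _ a2 d2.
  apply: (@is_derive_eq _ _ _ _ _ _ _ _ (is_deriveB a3 (is_deriveB m1 m2))).
  rewrite /GRing.scale /=.
  by field; apply/andP; split; rewrite gt_eqF//; lra.
- move=> /andP[x0 xv].
  rewrite oppr_ge0 -lnM ?posrE; [|lra|lra].
  by apply: ln_le0; nra.
Qed.

Lemma ln_exprn x n : 0 < x -> ln (x ^+ n) = n%:R * ln x.
Proof. by move=> x0; rewrite lnXn// mulr_natl. Qed.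

(** This bounds the growth of the factor k ^ k of the maximal likelihood when an
    observation equal to one is added; the factor k + 1 / 2 is the one by which
    the Krichevsky-Trofimov numerator grows. *)
Lemma succ_pow_le k :
  k.+1%:R ^+ k.+1 <= expR 1 * (k%:R + 2^-1) * k%:R ^+ k :> R.
Proof.
case: k => [|k].
  rewrite !expr0 expr1 mulr1 add0r.
  have := @expR_ge1Dx R 1; lra.
set a : R := k.+1%:R; have a1 : 1 <= a by rewrite ler1n.
have -> : k.+2%:R = a + 1 :> R by rewrite natr1.
(* a and a + 1 are written c (1 - v) and c (1 + v), with c their midpoint. *)
pose c := a + 2^-1; pose v := (2 * c)^-1.
have c0 : 0 < c by rewrite /c; lra.
have v01 : 0 <= v < 1 by rewrite /v invr_ge0 invf_lt1; rewrite /c; lra.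
have c1 : c * (1 + v) = a + 1 by rewrite /v /c; field; lra.
have c2 : c * (1 - v) = a by rewrite /v /c; field; lra.
have p1 : 0 < 1 + v by lra.
have p2 : 0 < 1 - v by lra.
have a0 : 0 < a by lra.
have a10 : 0 < a + 1 by lra.
rewrite -ler_ln ?posrE ?exprn_gt0 ?mulr_gt0 ?expR_gt0 ?exprn_gt0//.
rewrite ln_exprn// !lnM ?posrE ?exprn_gt0 ?mulr_gt0 ?expR_gt0//.
rewrite ln_exprn//.
rewrite expRK -/c -[in X in X <= _]c1 -[in X in _ <= X]c2 !lnM ?posrE//.
have := xlnx_midpoint v01.
move: (ln (1 + v)) (ln (1 - v)) (ln c) => p q l h.
rewrite -natr1 -/a.
have e1 : c * v = 2^-1 by rewrite /v; field; lra.
have : c * ((1 + v) * p - (1 - v) * q) <= c * (2 * v) by rewrite ler_pM2l.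
have -> : c * ((1 + v) * p - (1 - v) * q) = (a + 1) * p - a * q.
  by rewrite -{1}c1 -c2; ring.
rewrite mulrCA e1; lra.
Qed.

(** The factor e lost in [succ_pow_le] is recovered from the factors that depend
    on the sample size alone. *)
Lemma pow_sqrt_le n :
  expR 1 * Num.sqrt n%:R * n%:R ^+ n <= Num.sqrt n.+1%:R * n.+1%:R ^+ n :> R.
Proof.
case: n => [|n]; first by rewrite sqrtr0 mulr0 mul0r mulr1 sqrtr_ge0.
set a : R := n.+1%:R; have a1 : 1 <= a by rewrite ler1n.
have -> : n.+2%:R = a + 1 :> R by rewrite natr1.
pose c := a + 2^-1; pose v := (2 * c)^-1.
have c0 : 0 < c by rewrite /c; lra.
have v01 : 0 <= v < 1 by rewrite /v invr_ge0 invf_lt1; rewrite /c; lra.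
have c1 : c * (1 + v) = a + 1 by rewrite /v /c; field; lra.
have c2 : c * (1 - v) = a by rewrite /v /c; field; lra.
have p1 : 0 < 1 + v by lra.
have p2 : 0 < 1 - v by lra.
have a0 : 0 < a by lra.
have a10 : 0 < a + 1 by lra.
have lns x : 0 < x -> ln (Num.sqrt x) = 2^-1 * ln x.
  move=> x0; rewrite -{2}(@sqr_sqrtr _ x) ?ltW// lnXn ?sqrtr_gt0//.
  by rewrite -mulr_natl; field.
rewrite -ler_ln ?posrE ?mulr_gt0 ?expR_gt0 ?exprn_gt0 ?sqrtr_gt0//.
rewrite !lnM ?posrE ?mulr_gt0 ?expR_gt0 ?exprn_gt0 ?sqrtr_gt0//.
rewrite !ln_exprn// !lns// expRK -/a.
rewrite -[in X in _ <= X]c1 -[in X in X <= _]c2 !lnM ?posrE//.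
have := ln_ratio_ge v01.
move: (ln (1 + v)) (ln (1 - v)) (ln c) => p q l h.
have e1 : c * v = 2^-1 by rewrite /v; field; lra.
have : c * (2 * v) <= c * (p - q) by rewrite ler_pM2l.
rewrite mulrCA e1 c2 /c; lra.
Qed.
End logarithm.

(** * The Krichevsky-Trofimov mixture and its redundancy *)

(** The Krichevsky-Trofimov probability of a binary sequence with k ones and m
    zeros: the integral of u ^ k (1 - u) ^ m against the Beta(1/2, 1/2) law. *)
Definition kt (R : realType) (k m : nat) : R :=
  (\prod_(i < k) (i%:R + 2^-1)) * (\prod_(j < m) (j%:R + 2^-1)) / (k + m)`!%:R.

Section krichevsky_trofimov.
Variable R : realType.
Implicit Types (u y : R) (k m n : nat) (z : seq bool).
Local Notation kt := (kt R).

Lemma kt_gt0 k m : 0 < kt k m.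
Proof.
by rewrite divr_gt0 ?ltr0n ?fact_gt0// mulr_gt0// prodr_gt0// => i _;
   rewrite ltr_wpDl// invr_gt0.
Qed.

Lemma ktC k m : kt k m = kt m k.
Proof. by rewrite /kt addnC [X in X / _]mulrC. Qed.

Lemma ktS k m : kt k.+1 m = kt k m * ((k%:R + 2^-1) / (k + m).+1%:R).
Proof.
rewrite /kt big_ord_recr /= addSn factS natrM; field.
by rewrite -natrD nat1r !pnatr_eq0 /= -lt0n fact_gt0.
Qed.

(** Consistency of the mixture: a sequence is followed by a one or by a zero. *)
Lemma kt_split k m : kt k.+1 m + kt k m.+1 = kt k m.
Proof.
rewrite ktS [kt k m.+1]ktC ktS [kt m k]ktC (addnC m) -(natr1 (k + m)) natrD.
field.
by rewrite -natrD natr1 pnatr_eq0.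
Qed.

(** The power k of y / k <= exp (y / k - 1), without division by k = 0. *)
Lemma pow_le_expR y k : 0 <= y -> y ^+ k <= k%:R ^+ k * expR (y - k%:R).
Proof.
case: k => [|k] y0.
  by rewrite !expr0 mul1r subr0 -expR0 ler_expR.
set a : R := k.+1%:R; have a0 : 0 < a by rewrite ltr0n.
have ya : y / a <= expR (y / a - 1).
  by apply: le_trans (expR_ge1Dx _); rewrite addrC subrK.
have -> : y - a = (y / a - 1) * k.+1%:R by rewrite -/a; field; rewrite gt_eqF.
rewrite expRM_natr -exprMn lerXn2r ?nnegrE//.
  by rewrite mulr_ge0 ?expR_ge0// ltW.
by rewrite mulrC -ler_pdivrMr.
Qed.

(** The likelihood is maximal at the empirical frequency k / (k + m).  Applying
    [pow_le_expR] to the expected counts u n and (1 - u) n leaves the factor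
    exp (n - k - m) = 1. *)
Lemma lik_le_mle u k m : 0 <= u <= 1 ->
  u ^+ k * (1 - u) ^+ m * (k + m)%:R ^+ (k + m) <= k%:R ^+ k * m%:R ^+ m.
Proof.
case/andP=> u0 u1.
set n : R := (k + m)%:R; have n0 : 0 <= n by rewrite ler0n.
rewrite exprD mulrACA -!exprMn.
have h1 := @pow_le_expR (u * n) k (mulr_ge0 u0 n0).
have h2 := @pow_le_expR ((1 - u) * n) m ltac:(rewrite mulr_ge0//; lra).
apply: le_trans (ler_pM _ _ h1 h2) _; rewrite ?exprn_ge0 ?mulr_ge0//; try lra.
rewrite mulrACA -expRD.
have -> : u * n - k%:R + ((1 - u) * n - m%:R) = 0 by rewrite /n natrD; ring.
by rewrite expR0 mulr1.
Qed.

(* The bound on the maximal likelihood, with denominators cleared so that it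
   makes sense for k = 0 or m = 0; it fails for k = m = 0. *)
Let mle_le_kt k m :=
  k%:R ^+ k * m%:R ^+ m <=
  2 * kt k m * Num.sqrt (k + m)%:R * (k + m)%:R ^+ (k + m).

Let mle_le_ktC k m : mle_le_kt k m -> mle_le_kt m k.
Proof. by rewrite /mle_le_kt ktC addnC [X in X <= _]mulrC. Qed.

Let mle_le_ktS k m : mle_le_kt k m -> mle_le_kt k.+1 m.
Proof.
rewrite /mle_le_kt => IH.
set n := (k + m)%N.
have e0 := expR_gt0 (1 : R).
have k0 : 0 < k%:R + 2^-1 :> R by rewrite ltr_wpDl// invr_gt0.
apply: le_trans (_ : expR 1 * (k%:R + 2^-1) * (k%:R ^+ k * m%:R ^+ m) <= _).
  by rewrite mulrA ler_wpM2r ?exprn_ge0 ?ler0n ?succ_pow_le.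
apply: le_trans (_ : expR 1 * (k%:R + 2^-1) *
    (2 * kt k m * Num.sqrt n%:R * n%:R ^+ n) <= _).
  by rewrite ler_wpM2l// mulr_ge0// ltW.
have -> : expR 1 * (k%:R + 2^-1) * (2 * kt k m * Num.sqrt n%:R * n%:R ^+ n) =
    2 * kt k m * (k%:R + 2^-1) * (expR 1 * Num.sqrt n%:R * n%:R ^+ n) by ring.
have -> : 2 * kt k.+1 m * Num.sqrt (k.+1 + m)%:R * (k.+1 + m)%:R ^+ (k.+1 + m) =
    2 * kt k m * (k%:R + 2^-1) * (Num.sqrt n.+1%:R * n.+1%:R ^+ n).
  rewrite ktS addSn -/n exprS; field.
  by rewrite nat1r pnatr_eq0.
have kt0 := kt_gt0 k m.
have c0 : 0 <= 2 * kt k m := mulr_ge0 (ler0n _ 2) (ltW kt0).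
by rewrite ler_wpM2l ?pow_sqrt_le// (mulr_ge0 c0 (ltW k0)).
Qed.

Let mle_kt k m : (0 < k + m)%N -> mle_le_kt k m.
Proof.
have base m' : mle_le_kt 1 m'.
  elim: m' => [|m' /mle_le_ktC IH]; last exact/mle_le_ktC/mle_le_ktS.
  rewrite /mle_le_kt /kt big_ord_recl !big_ord0 addn0 !expr1 sqrtr1.
  by rewrite le_eqVlt; apply/orP; left; apply/eqP; rewrite /= ?mulr1n; field.
case: k => [|k _].
  case: m => // m _; apply: mle_le_ktC.
  by elim: m => [|m]; [exact: base | exact: mle_le_ktS].
by elim: k => [|k]; [exact: base | exact: mle_le_ktS].
Qed.

(** The redundancy of the Krichevsky-Trofimov mixture is at most
    ln (2 sqrt n).  The ratio between the mixture times sqrt n and the maximal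
    likelihood does not decrease when an observation is added, and it equals
    1 / 2 for a single observation. *)
Theorem lik_le_kt u k m : (0 < k + m)%N -> 0 <= u <= 1 ->
  u ^+ k * (1 - u) ^+ m <= 2 * Num.sqrt (k + m)%:R * kt k m.
Proof.
move=> n0 u01; have nn0 : 0 < (k + m)%:R ^+ (k + m) :> R.
  by rewrite exprn_gt0// ltr0n.
rewrite -(ler_pM2r nn0); apply: le_trans (lik_le_mle _ _ u01) _.
by rewrite [2 * _ * kt k m]mulrAC; exact: mle_kt.
Qed.

Lemma likE u z : lik u z = u ^+ count id z * (1 - u) ^+ count negb z.
Proof.
rewrite /lik; elim: z => [|b z IH]; first by rewrite big_nil mulr1.
rewrite big_cons IH; case: b => /=; rewrite !exprD ?expr0 ?expr1; ring.
Qed.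

Definition ktseq z := kt (count id z) (count negb z).

Lemma lik_le_ktseq u z : (0 < size z)%N -> 0 <= u <= 1 ->
  lik u z <= 2 * Num.sqrt (size z)%:R * ktseq z.
Proof.
rewrite -(count_predC id z) likE; exact: lik_le_kt.
Qed.

Lemma ktseq_rcons z : ktseq (rcons z true) + ktseq (rcons z false) = ktseq z.
Proof.
by rewrite /ktseq -!cats1 !count_cat /= !addn0 !addn1; exact: kt_split.
Qed.
End krichevsky_trofimov.

(** * Histories of a bandit and Ville's inequality *)

Section history.
Variable K : nat.
Implicit Types (x : nat -> bool) (a : nat -> 'I_K) (h : seq ('I_K * bool)).

Definition hist x a (t : nat) : seq ('I_K * bool) :=
  [seq (a s, x s) | s <- iota 1 t].

Lemma size_hist x a t : size (hist x a t) = t.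
Proof. by rewrite size_map size_iota. Qed.

Lemma histS x a t : hist x a t.+1 = rcons (hist x a t) (a t.+1, x t.+1).
Proof. by rewrite /hist -{1}(addn1 t) iotaD map_cat cats1 add1n. Qed.

Lemma take_hist x a s t : (s <= t)%N -> take s (hist x a t) = hist x a s.
Proof. by move=> st; rewrite /hist -map_take take_iota (minn_idPl st). Qed.

Definition arm_obs (i : 'I_K) h : seq bool := [seq z.2 | z <- h & z.1 == i].

Lemma obs_hist x a i t : obs x a i t = arm_obs i (hist x a t).
Proof. by rewrite /arm_obs /hist filter_map -map_comp. Qed.

Lemma arm_obs_rcons i h z :
  arm_obs i (rcons h z) = if z.1 == i then rcons (arm_obs i h) z.2 else arm_obs i h.
Proof. by rewrite /arm_obs filter_rcons; case: ifP; rewrite ?map_rcons. Qed.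
End history.

Section finite_measure_sums.
Context {d} {T : measurableType d} {R : realType} (P : probability T R).

Lemma prob_cover (I : finType) (F : I -> set T) (E : set T) :
  measurable E -> (forall i, measurable (F i)) -> E `<=` \bigcup_i F i ->
  (P E <= \sum_i P (F i))%E.
Proof.
move=> mE mF EF.
have := @content_sub_fsum _ R _ P I setT E F (@finite_finset _ _)
  (fun i _ => mF i) mE EF.
rewrite (_ : [set: I] = [set` enum I]); last first.
  by apply/seteqP; split=> i //= _; rewrite mem_enum.
by rewrite -fsbig_seq ?enum_uniq// big_enum.
Qed.

Lemma prob_partition (I : finType) (F : I -> set T) :
  (forall i, measurable (F i)) -> trivIset setT F ->
  P (\bigcup_i F i) = (\sum_i P (F i))%E.
Proof.
move=> mF tF; rewrite measure_fin_bigcup//; last exact: finite_finset.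
rewrite (_ : [set: I] = [set` enum I]); last first.
  by apply/seteqP; split=> i //= _; rewrite mem_enum.
by rewrite -fsbig_seq ?enum_uniq// big_enum.
Qed.
End finite_measure_sums.

Section filtration_lemmas.
Context {d} {T : measurableType d} (K : nat).
Variables (X : nat -> {mfun T >-> bool}) (A : nat -> T -> 'I_K).
Hypothesis hA : sampling_rule X A.

Lemma filtration_measurable t E : filtration X t E -> measurable E.
Proof.
apply: smallest_sub => [|B [s _ [C mC <-]]].
  exact: sigma_algebra_measurable.
by apply: measurable_funP.
Qed.

Lemma filtrationS t E : filtration X t E -> filtration X t.+1 E.
Proof.
apply: sub_sigma_algebra2 => B [s /andP[s0 st] Bs].
by exists s => //=; rewrite s0 ltnW.
Qed.

Definition hist_at (t : nat) (w : T) := hist (X^~ w) (A^~ w) t.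

(** The actions in the history of length t are themselves functions of
    X_1, ..., X_(t-1), so the history carries no more than F_t. *)
Lemma filtration_hist t (Q : set (seq ('I_K * bool))) :
  filtration X t [set w | Q (hist_at t w)].
Proof.
elim: t Q => [|t IH] Q.
  have [q|q] := pselect (Q [::]).
    have -> : [set w | Q (hist_at 0 w)] = setT by apply/seteqP; split.
    exact: (@measurableT _ (g_sigma_algebraType
      (\bigcup_(s in [set s : nat | (1 <= s <= 0)%N])
         preimage_set_system setT (X s) measurable))).
  have -> : [set w | Q (hist_at 0 w)] = set0 by apply/seteqP; split.
  exact: sigma_algebra0.
have -> : [set w | Q (hist_at t.+1 w)] =
  \bigcup_(z in [set: 'I_K * bool]) ([set w | Q (rcons (hist_at t w) z)] `&`
     A t.+1 @^-1` [set z.1] `&` X t.+1 @^-1` [set z.2]).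
  apply/seteqP; split=> w /=; rewrite /hist_at histS.
    by move=> Qw; exists (A t.+1 w, X t.+1 w).
  by case=> -[i b] _ /= [[Qw Ai] Xb]; rewrite Ai Xb.
apply: (@fin_bigcup_measurable _ (g_sigma_algebraType
  (\bigcup_(s in [set s : nat | (1 <= s <= t.+1)%N])
     preimage_set_system setT (X s) measurable))) => // -[i b] _.
apply: measurableI; first apply: measurableI.
- exact: (filtrationS (IH [set h | Q (rcons h (i, b))])).
- apply: filtrationS; exact: (hA (ltn0Sn t)).
- apply: sub_sigma_algebra; exists t.+1 => /=; first by rewrite leqnn.
  by exists [set b] => //; rewrite setTI.
Qed.

Lemma measurable_hist t (Q : set (seq ('I_K * bool))) :
  measurable [set w | Q (hist_at t w)].
Proof. exact: (filtration_measurable (filtration_hist Q)). Qed.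
End filtration_lemmas.

Section ville.
Context {d} {T : measurableType d} {R : realType} (K : nat).
Variables (X : nat -> {mfun T >-> bool}) (A : nat -> T -> 'I_K).
Hypothesis hA : sampling_rule X A.
Variables (P : probability T R) (mu : 'I_K -> R).
Hypothesis model : bandit_model P mu X A.
Hypothesis mu01 : forall i, 0 <= mu i <= 1.
Variable M : seq ('I_K * bool) -> R.
Hypothesis M_ge0 : forall h, 0 <= M h.
Hypothesis M_super : forall h i,
  mu i * M (rcons h (i, true)) + (1 - mu i) * M (rcons h (i, false)) <= M h.

Let cyl h := [set w | hist_at X A (size h) w = h].

Let measurable_cyl h : measurable (cyl h).
Proof. exact: (measurable_hist hA (size h) [set h' | h' = h]). Qed.

(* The model gives the law of the next reward on these events only, so the step
   from a history to its extensions passes through them. *)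
Let branch h i := cyl h `&` A (size h).+1 @^-1` [set i].

Let measurable_branch h i : measurable (branch h i).
Proof.
apply: measurableI => //.
exact: (filtration_measurable (hA (ltn0Sn (size h)) i)).
Qed.

Let cyl_rcons h i b :
  P (cyl (rcons h (i, b))) = (P (branch h i) * (if b then mu i else 1 - mu i)%:E)%E.
Proof.
have -> : cyl (rcons h (i, b)) = branch h i `&` X (size h).+1 @^-1` [set b].
  apply/seteqP; split=> w; rewrite /branch /cyl /= size_rcons /hist_at histS.
    by move/rcons_inj => [-> -> ->].
  by case=> -[-> ->] ->.
rewrite (model (ltn0Sn (size h))) ?/bernoulli_prob ?mu01 ?fsbig_set1//.
exact: (filtration_hist hA [set h' | h' = h]).
Qed.

(* The supermartingale property, averaged over the law of the next arm, which is
   arbitrary: only the law of the reward given the arm is used. *)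
Let one_step h :
  (\sum_z P (cyl (rcons h z)) * (M (rcons h z))%:E <= P (cyl h) * (M h)%:E)%E.
Proof.
have pE E : measurable E -> P E = (fine (P E))%:E.
  by move=> mE; rewrite fineK// fin_num_measure.
have -> : cyl h = \bigcup_i branch h i.
  by apply/seteqP; split=> [w Cw|w [i _ []]//]; exists (A (size h).+1 w).
rewrite prob_partition; last 2 first.
- exact: measurable_branch.
- by move=> i j _ _ [w [[_ <-] [_ <-]]].
rewrite ge0_sume_distrl//.
pose F i b := (P (cyl (rcons h (i, b))) * (M (rcons h (i, b)))%:E)%E.
rewrite (eq_bigr (fun z => F z.1 z.2)); last by case.
rewrite -(pair_bigA _ F) /F /=.
apply: lee_sum => i _; rewrite big_bool /= !cyl_rcons.
rewrite pE// -!EFinM -EFinD lee_fin -!mulrA -mulrDr.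
by rewrite ler_wpM2l ?fine_ge0.
Qed.

Variable Q : set (seq ('I_K * bool)).
Hypothesis Q_large : forall h, Q h -> 1 <= M h.

Let hit n h := cyl h `&` \bigcup_(k in [set k | (k <= n)%N])
  [set w | Q (hist_at X A (size h + k) w)].

Let measurable_hit n h : measurable (hit n h).
Proof.
apply: measurableI => //; apply: bigcup_measurable => k _.
exact: measurable_hist.
Qed.

(* Induction on the horizon n, for all histories at once: either Q already holds
   at h, and then M h >= 1, or the event splits along the extensions of h. *)
Let hit_le n h : (P (hit n h) <= P (cyl h) * (M h)%:E)%E.
Proof.
elim: n h => [|n IH] h; have [q|q] := pselect (Q h).
- apply: le_trans (_ : P (cyl h) <= _)%E.
    by rewrite le_measure ?inE// => w [].
  by rewrite lee_pemulr// lee_fin Q_large.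
- rewrite (_ : hit 0 h = set0) ?measure0 ?mule_ge0 ?lee_fin//.
  apply/seteqP; split=> // w [/= Cw [k /=]]; rewrite leqn0 => /eqP ->.
  by rewrite addn0 Cw.
- apply: le_trans (_ : P (cyl h) <= _)%E.
    by rewrite le_measure ?inE// => w [].
  by rewrite lee_pemulr// lee_fin Q_large.
- apply: le_trans (one_step h).
  apply: le_trans (_ : \sum_z P (hit n (rcons h z)) <= _)%E; last first.
    by apply: lee_sum => z _; exact: IH.
  apply: prob_cover => // w [/= Cw [[|k] /= kn]].
    by rewrite addn0 Cw.
  move=> Qw; exists (A (size h).+1 w, X (size h).+1 w) => //.
  split; rewrite /cyl /= size_rcons.
    by rewrite /hist_at histS -/(hist_at X A _ _) Cw.
  by exists k => //=; rewrite addSnnS.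
Qed.

(** Ville's maximal inequality, on the tree of histories: [hit_le] at the root
    bounds the probability of reaching Q within a finite horizon, uniformly in
    the horizon, and these events increase to the whole event. *)
Theorem ville : (P [set w | exists t, Q (hist_at X A t w)] <= (M [::])%:E)%E.
Proof.
have -> : [set w | exists t, Q (hist_at X A t w)] = \bigcup_n hit n [::].
  apply/seteqP; split=> [w [t Qw]|w [n _ [_ [k _ Qw]]]]; last by exists k.
  by exists t => //; split=> //; exists t => /=.
have nd : nondecreasing_seq (hit ^~ [::]).
  move=> m n mn; apply/subsetPset => w [Cw [k /= km Qw]]; split => //.
  by exists k => //=; exact: leq_trans mn.
have mhit n : measurable (hit n [::]) by [].
have cv := nondecreasing_cvg_mu (mu := P) mhit (bigcupT_measurable _ mhit) nd.
rewrite -(cvg_lim _ cv)//; apply: lime_le.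
  by apply/cvg_ex; exists (P (\bigcup_n hit n [::])).
apply: nearW => n /=; apply: le_trans (hit_le _ _) _.
rewrite -[leRHS]mul1e; apply: lee_wpmul2r; rewrite ?lee_fin//.
exact: probability_le1.
Qed.
End ville.

(** * Generalized likelihood ratios *)

Section glr.
Variable R : realType.
Implicit Types (u v : R) (z za zb : seq bool) (C : rel R).

Lemma lik_ge0 u z : 0 <= u <= 1 -> 0 <= lik u z.
Proof. by case/andP=> u0 u1; rewrite likE mulr_ge0// exprn_ge0// subr_ge0. Qed.

Lemma lik_le1 u z : 0 <= u <= 1 -> lik u z <= 1.
Proof.
case/andP=> u0 u1; rewrite likE mulr_ile1 ?exprn_ge0 ?subr_ge0// exprn_ile1//.
  by rewrite subr_ge0.
by rewrite lerBlDr lerDl.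
Qed.

Lemma lik_gt0 u z : 0 < u < 1 -> 0 < lik u z.
Proof. by case/andP=> u0 u1; rewrite likE mulr_gt0// exprn_gt0// subr_gt0. Qed.

Lemma max_lik_ge C za zb u v : 0 <= u <= 1 -> 0 <= v <= 1 -> C u v ->
  lik u za * lik v zb <= max_lik C za zb.
Proof.
move=> u01 v01 Cuv; apply: ub_le_sup; last first.
  by exists (u, v) => //=; rewrite u01 v01.
exists 1 => _ [[u' v'] /= /and3P[u01' v01' _] <-].
by rewrite mulr_ile1 ?lik_ge0 ?lik_le1.
Qed.

Lemma max_lik_le C za zb (B : R) : reflexive C ->
  (forall u v, 0 <= u <= 1 -> 0 <= v <= 1 -> C u v -> lik u za * lik v zb <= B) ->
  max_lik C za zb <= B.
Proof.
move=> rC le_B; apply: ge_sup.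
  by exists (lik 0 za * lik 0 zb), (0, 0) => //=; rewrite lexx ler01 rC.
by move=> _ [[u v] /= /and3P[u01 v01 Cuv] <-]; exact: le_B.
Qed.

Lemma max_lik_gt0 C za zb : reflexive C -> 0 < max_lik C za zb.
Proof.
move=> rC; have h : 0 < (2^-1 : R) < 1 by apply/andP; split; lra.
have h' : 0 <= (2^-1 : R) <= 1 by apply/andP; split; lra.
apply: lt_le_trans (max_lik_ge za zb h' h' (rC _)).
by rewrite mulr_gt0// lik_gt0.
Qed.

Definition mean z : R := (size z)%:R^-1 * (count id z)%:R.

Lemma mean01 z : 0 <= mean z <= 1.
Proof.
rewrite /mean mulr_ge0 ?invr_ge0//=.
have [->|z0] := posnP (size z); first by rewrite invr0 mul0r ler01.
by rewrite ler_pdivrMl ?ltr0n// mulr1 ler_nat count_size.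
Qed.

Lemma lik_le_mean u z : 0 <= u <= 1 -> lik u z <= lik (mean z) z.
Proof.
move=> u01; have [/size0nil->|z0] := posnP (size z).
  by rewrite !likE.
have nn0 : 0 < (size z)%:R :> R by rewrite ltr0n.
have := lik_le_mle (count id z) (count negb z) u01.
rewrite -likE -[count negb z]/(count (predC id) z) count_predC.
move=> h; rewrite -(ler_pM2r (exprn_gt0 (size z) nn0)); apply: le_trans h _.
have -> : (size z)%:R ^+ size z = (size z)%:R ^+ count id z *
    (size z)%:R ^+ count (predC id) z :> R by rewrite -exprD count_predC.
rewrite likE mulrACA -!exprMn.
have -> : mean z * (size z)%:R = (count id z)%:R.
  by rewrite /mean mulrAC mulVf ?mul1r// gt_eqF.
have -> // : (1 - mean z) * (size z)%:R = (count (predC id) z)%:R.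
rewrite mulrBl mul1r /mean mulrAC mulVf ?mul1r ?gt_eqF//.
by rewrite -{1}(count_predC id z) natrD addrC addKr.
Qed.

Definition glrseq za zb : R :=
  ln (max_lik (fun x y => x >= y) za zb / max_lik (fun x y => x <= y) za zb).

(** It suffices that every pair on the side u >= v is dominated by a pair on the
    side u <= v. *)
Lemma glrseq_le0 za zb :
  (forall u v, 0 <= u <= 1 -> 0 <= v <= 1 -> v <= u -> exists u' v',
     [/\ 0 <= u' <= 1, 0 <= v' <= 1, u' <= v' &
         lik u za * lik v zb <= lik u' za * lik v' zb]) ->
  glrseq za zb <= 0.
Proof.
move=> dom; apply: ln_le0.
have refl_le : reflexive (fun x y : R => x <= y) by move=> ?; exact: lexx.
have refl_ge : reflexive (fun x y : R => x >= y) by move=> ?; exact: lexx.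
rewrite ler_pdivrMr ?mul1r ?max_lik_gt0//.
apply: max_lik_le => // u v u01 v01 vu.
have [u' [v' [u01' v01' uv' h]]] := dom u v u01 v01 vu.
exact: le_trans h (max_lik_ge (C := fun x y => x <= y) _ _ u01' v01' uv').
Qed.

(** If an arm is undrawn its parameter is free, so both constraints can be met
    without changing the likelihood; if both are drawn and the empirical means
    are in the wrong order, they are the unconstrained maximizers and satisfy
    the constraint of the denominator. *)
Lemma glrseq_gt0 za zb : 0 < glrseq za zb ->
  [/\ (0 < size za)%N, (0 < size zb)%N & mean zb < mean za].
Proof.
move=> z0; split.
- have [/size0nil za0|//] := posnP (size za).
  move: z0; rewrite ltNge glrseq_le0// => u v u01 v01 _.
  by exists v, v; split=> //; rewrite za0 !likE !expr0.
- have [/size0nil zb0|//] := posnP (size zb).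
  move: z0; rewrite ltNge glrseq_le0// => u v u01 v01 _.
  by exists u, u; split=> //; rewrite zb0 !likE !expr0.
- rewrite ltNge; apply/negP => mm.
  move: z0; rewrite ltNge glrseq_le0// => u v u01 v01 _.
  exists (mean za), (mean zb); split; rewrite ?mean01//.
  by apply: ler_pM; rewrite ?lik_ge0 ?lik_le_mean.
Qed.

(** The factor 2t is 4 sqrt (n_a n_b) bounded by the inequality between the
    arithmetic and geometric means. *)
Lemma lik_le_ktseq2 u v za zb (t : nat) : 0 <= u <= 1 -> 0 <= v <= 1 ->
  (0 < size za)%N -> (0 < size zb)%N -> (size za + size zb <= t)%N ->
  lik u za * lik v zb <= 2 * t%:R * (ktseq R za * ktseq R zb).
Proof.
move=> u01 v01 za0 zb0 le_t.
have := lik_le_ktseq za0 u01; have := lik_le_ktseq zb0 v01.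
have : 0 < ktseq R za by exact: kt_gt0.
have : 0 < ktseq R zb by exact: kt_gt0.
have := lik_ge0 za u01; have := lik_ge0 zb v01.
have := @sqr_sqrtr R (size za)%:R ltac:(by []).
have := @sqr_sqrtr R (size zb)%:R ltac:(by []).
have : (size za)%:R + (size zb)%:R <= t%:R :> R by rewrite -natrD ler_nat.
move: (Num.sqrt _) (Num.sqrt _) (lik u za) (lik v zb) (ktseq R za) (ktseq R zb).
move=> p q la lb ka kb st pE qE lb0 la0 kb0 ka0 hb ha.
apply: le_trans (ler_pM la0 lb0 ha hb) _.
have -> : 2 * p * ka * (2 * q * kb) = 4 * (p * q) * (ka * kb) by ring.
rewrite ler_wpM2r ?(mulr_ge0 (ltW ka0) (ltW kb0))//.
have := sqr_ge0 (p - q).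
have -> : (p - q) ^+ 2 = p ^+ 2 + q ^+ 2 - 2 * (p * q) by ring.
lra.
Qed.

Definition ktratio u z : R := ktseq R z / lik u z.

Lemma ktratio_gt0 u z : 0 < u < 1 -> 0 < ktratio u z.
Proof. by move=> u01; rewrite divr_gt0 ?lik_gt0// kt_gt0. Qed.

Lemma ktratio_fair u z : 0 < u < 1 ->
  u * ktratio u (rcons z true) + (1 - u) * ktratio u (rcons z false)
    = ktratio u z.
Proof.
move=> u01; have l0 := lik_gt0 z u01; case/andP: u01 => u0 u1.
have u1' : 1 - u != 0 by rewrite gt_eqF// subr_gt0.
have lr b : lik u (rcons z b) = lik u z * (if b then u else 1 - u).
  rewrite /lik -cats1 big_cat big_seq1 /=.
  by case: b; rewrite /= expr1 expr0 ?mulr1 ?mul1r.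
rewrite /ktratio -(ktseq_rcons R z) !lr; field.
by rewrite u1' !gt_eqF.
Qed.
End glr.

Lemma emp_mean_hist (R : realType) K (x : nat -> bool) (a : nat -> 'I_K) t i :
  emp_mean R x a t i = mean R (arm_obs i (hist x a t)).
Proof.
rewrite -obs_hist /emp_mean /mean /draws /obs /index_iota subSS subn0.
congr (_%:R^-1 * _).
  rewrite size_map size_filter -sum1_count [RHS]big_mkcond.
  by apply: eq_bigr => s _; case: (a s == i).
rewrite count_map -sum1_count big_filter_cond natr_sum.
rewrite big_mkcond /= [RHS]big_mkcond /=; apply: eq_bigr => s _.
by case: (x s); case: (a s == i); rewrite ?mulr1 ?mulr0.
Qed.

Lemma size_arm_obs_le K (i j : 'I_K) h : i != j ->
  (size (arm_obs i h) + size (arm_obs j h) <= size h)%N.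
Proof.
move=> ij; rewrite !size_map !size_filter.
elim: h => //= z h IH; rewrite addnACA -[(size h).+1]add1n leq_add//.
case: eqVneq => [->|_]; first by rewrite (negbTE ij).
by case: eqP.
Qed.

Lemma first_timeP (p : pred nat) t :
  first_time p = Some t <-> p t /\ forall s, (s < t)%N -> ~~ p s.
Proof.
rewrite /first_time; case: pselect => [ex|nex]; last first.
  by split=> // -[pt _]; case: nex; exists t.
case: ex_minnP => m pm minm; split=> [[<-]|[pt mint]].
  by split=> // s; apply: contraL => /minm; rewrite -leqNgt.
congr Some; apply/eqP; rewrite eqn_leq minm//=.
by rewrite leqNgt; apply/negP => /mint; rewrite pm.
Qed.

(** * Crossing probabilities and the stopping rule *)

Section crossing.
Context {d} {T : measurableType d} {R : realType} (K : nat).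
Variables (X : nat -> {mfun T >-> bool}) (A : nat -> T -> 'I_K).
Hypothesis hA : sampling_rule X A.
Variables (P : probability T R) (mu : 'I_K -> R).
Hypothesis model : bandit_model P mu X A.
Hypothesis mu01 : forall i, 0 < mu i < 1.

Definition crosses (eps : R) (i j : 'I_K) (h : seq ('I_K * bool)) : Prop :=
  (0 < size h)%N /\
  ln (2 * (size h)%:R / eps) < glrseq R (arm_obs i h) (arm_obs j h).

(** Ville's inequality for eps times the product of the two ratios between the
    Krichevsky-Trofimov probability and the true likelihood.  Drawing a third
    arm leaves the product unchanged. *)
Theorem glr_crossing (eps : R) (i j : 'I_K) : 0 < eps <= 1 -> i != j ->
  mu i <= mu j ->
  (P [set w | exists t, crosses eps i j (hist_at X A t w)] <= eps%:E)%E.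
Proof.
move=> /andP[eps0 eps1] ij muij.
pose M h := eps * (ktratio (mu i) (arm_obs i h) * ktratio (mu j) (arm_obs j h)).
have M0 : M [::] = eps.
  by rewrite /M /ktratio /ktseq /lik /kt !big_nil !big_ord0 fact0 !divr1 !mulr1.
rewrite -[X in (_ <= X%:E)%E]M0.
apply: (ville hA model) => [k|h|h k|h [h0 cr]].
- by case/andP: (mu01 k) => /ltW -> /ltW ->.
- by rewrite ltW// mulr_gt0// mulr_gt0// ktratio_gt0.
- rewrite /M !arm_obs_rcons /=.
  rewrite le_eqVlt; apply/orP; left; apply/eqP.
  have [->|ki] := eqVneq k i.
    rewrite (negbTE ij) -(ktratio_fair (arm_obs i h) (mu01 i)); ring.
  have [->|kj] := eqVneq k j; last by ring.
  rewrite -(ktratio_fair (arm_obs j h) (mu01 j)); ring.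
- set za := arm_obs i h in cr *; set zb := arm_obs j h in cr *.
  pose B := 2 * (size h)%:R / eps.
  have h1 : 1 <= (size h)%:R :> R by rewrite ler1n.
  have B1 : 1 < B by rewrite /B ltr_pdivlMr//; lra.
  have B0 : 0 < B by apply: lt_trans B1.
  have [za0 zb0 _] := glrseq_gt0 (lt_trans (ln_gt0 B1) cr).
  set num := max_lik (fun x y : R => x >= y) za zb.
  set den := max_lik (fun x y : R => x <= y) za zb.
  have den0 : 0 < den by apply: max_lik_gt0 => ?; exact: lexx.
  have num0 : 0 < num by apply: max_lik_gt0 => ?; exact: lexx.
  have ltB : B * den < num.
    rewrite -ltr_pdivlMr//.
    by have := cr; rewrite /glrseq ltr_ln ?posrE// divr_gt0.
  have w01 k : 0 <= mu k <= 1 by case/andP: (mu01 k) => /ltW -> /ltW ->.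
  have den_ge : lik (mu i) za * lik (mu j) zb <= den.
    exact: (max_lik_ge (C := fun x y : R => x <= y)).
  have num_le : num <= 2 * (size h)%:R * (ktseq R za * ktseq R zb).
    apply: max_lik_le => [?|u v u01 v01 _]; first exact: lexx.
    by apply: lik_le_ktseq2 => //; exact: size_arm_obs_le.
  have la0 := lik_gt0 za (mu01 i); have lb0 := lik_gt0 zb (mu01 j).
  have -> : M h = eps * (ktseq R za * ktseq R zb) /
      (lik (mu i) za * lik (mu j) zb).
    by rewrite /M /ktratio -/za -/zb; field; rewrite !gt_eqF.
  rewrite ler_pdivlMr ?mulr_gt0// mul1r.
  have t0 : 0 < 2 * (size h)%:R :> R by lra.
  rewrite -(ler_pM2l t0).
  have : eps * (B * den) <= eps * (2 * (size h)%:R * (ktseq R za * ktseq R zb)).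
    by rewrite ler_pM2l// (le_trans (ltW ltB)).
  have -> : eps * (B * den) = 2 * (size h)%:R * den.
    by rewrite /B; field; rewrite gt_eqF.
  move=> hB.
  have hd : 2 * (size h)%:R * (lik (mu i) za * lik (mu j) zb) <=
      2 * (size h)%:R * den by rewrite ler_pM2l.
  by apply: le_trans hd (le_trans hB _); rewrite mulrCA.
Qed.

Lemma measurable_crossing eps i j :
  measurable [set w | exists t, crosses eps i j (hist_at X A t w)].
Proof.
rewrite (_ : [set w | _] = \bigcup_t [set w | crosses eps i j (hist_at X A t w)]).
  by apply: bigcupT_measurable => t; exact: measurable_hist.
by apply/seteqP; split=> w [t]; [exists t|move=> _ ?; exists t].
Qed.
End crossing.

Section stopping.
Context {R : realType} (K : nat).
Implicit Types (h : seq ('I_K * bool)) (beta : nat -> R).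

Definition beats beta h i j : Prop :=
  beta (size h) < glrseq R (arm_obs i h) (arm_obs j h).

Definition stops beta h : Prop :=
  (0 < size h)%N /\ exists i, forall j, j != i -> beats beta h i j.

Lemma lt_glr_maxmin (x : nat -> bool) (a : nat -> 'I_K) (t : nat) (B : R) :
  (B%:E < glr_maxmin R x a t)%E <->
  exists i, forall j, j != i -> B < glr R x a i j t.
Proof.
rewrite /glr_maxmin; split=> [|[i Bi]].
  rewrite ltNge => /negP lt_max; apply: contrapT => /forallNP nex.
  apply: lt_max; apply/bigmax_leP; split=> [|i _]; first exact: leNye.
  rewrite leNgt; apply/negP => /bigmin_gtP[_ Bi]; apply: (nex i) => j ji.
  by rewrite -lte_fin; exact: Bi.
apply: lt_le_trans (le_bigmax _ _ i).
by apply/bigmin_gtP; split=> [|j ji]; rewrite ?ltry// lte_fin Bi.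
Qed.

(** The stopping time is decided by the history, so that paths with a common
    history stop together. *)
Lemma chernoff_timeP beta (x : nat -> bool) (a : nat -> 'I_K) t :
  chernoff_time beta x a = Some t <->
  stops beta (hist x a t) /\
  forall s, (s < t)%N -> ~ stops beta (take s (hist x a t)).
Proof.
have stopsE s : stops beta (hist x a s) <->
    (1 <= s)%N && ((beta s)%:E < glr_maxmin R x a s)%E.
  rewrite /stops /beats size_hist; split.
    move=> [-> [i ibeats]]; apply/lt_glr_maxmin; exists i => j ji.
    by rewrite /glr !obs_hist; exact: ibeats.
  move=> /andP[s0 /lt_glr_maxmin[i ibeats]]; split=> //.
  by exists i => j ji; move: (ibeats j ji); rewrite /glr !obs_hist.
rewrite /chernoff_time first_timeP -stopsE.
split=> -[st nst]; split=> // s lt_st.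
  rewrite (take_hist x a (ltnW lt_st)) => /stopsE; apply/negP.
  exact: nst s lt_st.
apply/negP => /stopsE; rewrite -(take_hist x a (ltnW lt_st)); exact: nst s lt_st.
Qed.

(** A test won with a nonnegative threshold orders two empirical means strictly
    ([glrseq_gt0]), so neither ties nor undrawn arms can occur here. *)
Lemma stops_winner beta h i (m : 'I_K) : 0 <= beta (size h) ->
  (forall j, j != i -> beats beta h i j) ->
  is_argmax (fun k => mean R (arm_obs k h)) m -> m = i.
Proof.
move=> beta0 ibeats mmax; apply/eqP/negPn/negP => mi.
have [_ _] := glrseq_gt0 (le_lt_trans beta0 (ibeats m mi)).
by rewrite ltNge mmax.
Qed.
End stopping.

Theorem theorem10 (R : realType) (K : nat) (hK : (2 <= K)%N)
    (delta : R) (hdelta : 0 < delta < 1)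
    (d : measure_display) (T : measurableType d)
    (X : nat -> {mfun T >-> bool}) (A : nat -> T -> 'I_K)
    (hA : sampling_rule X A) :
  let beta (t : nat) : R := ln (2 * t%:R * (K%:R - 1) / delta) in
  let tau (w : T) := chernoff_time beta (X^~ w) (A^~ w) in
  forall ahat : T -> 'I_K, decision_rule R X A tau ahat ->
  forall mu : 'I_K -> R, calS mu ->
  forall astar : 'I_K, is_argmax mu astar ->
  forall P : probability T R, bandit_model P mu X A ->
  (P [set w | tau w <> None /\ ahat w <> astar] <= delta%:E)%E.
Proof.
move=> beta tau ahat hahat mu [mu01 _] astar mumax P model.
case/andP: hdelta => delta0 delta1.
have K1 : 1 <= K%:R - 1 :> R by rewrite lerBrDr -(natrD _ 1 1) ler_nat.
pose eps := delta / (K%:R - 1).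
have eps01 : 0 < eps <= 1.
  by rewrite divr_gt0 ?ler_pdivrMr; lra.
have betaE t : beta t = ln (2 * t%:R / eps).
  by rewrite /beta /eps; congr ln; field; apply/andP; split; rewrite gt_eqF//; lra.
have beta_ge0 (h : seq ('I_K * bool)) : stops beta h -> 0 <= beta (size h).
  case=> h0 _; apply: ln_ge0; have h1 : 1 <= (size h)%:R :> R by rewrite ler1n.
  by rewrite ler_pdivlMr//; nra.
pose wrong (h : seq ('I_K * bool)) := [/\ stops beta h,
  (forall s, (s < size h)%N -> ~ stops beta (take s h)) &
  ~ is_argmax (fun k => mean R (arm_obs k h)) astar].
have ahatP w t : tau w = Some t ->
    is_argmax (fun k => mean R (arm_obs k (hist_at X A t w))) (ahat w).
  by move=> /hahat amax b; rewrite -!emp_mean_hist; exact: amax.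
(* The error event is rewritten on histories: ahat is an arbitrary function, and
   its measurability on the stopping paths comes from the uniqueness of the
   maximizer. *)
have -> : [set w | tau w <> None /\ ahat w <> astar] =
    \bigcup_t [set w | wrong (hist_at X A t w)].
  apply/seteqP; split=> w.
    case; case E : (tau w) => [t|//] _ ne; exists t => //.
    have [st nst] := (chernoff_timeP _ _ _ _).1 E.
    split; [exact: st|by rewrite size_hist|move=> smax; apply: ne].
    have [_ [i ibeats]] := st.
    have b0 := beta_ge0 _ st.
    by rewrite (stops_winner b0 ibeats (ahatP _ _ E)) (stops_winner b0 ibeats smax).
  case=> t _ [st nst nmax].
  have E : tau w = Some t.
    apply/chernoff_timeP; split; first exact: st.
    by move=> s lt_st; apply: nst; rewrite size_hist.
  split; first by rewrite E.
  by move=> e; apply: nmax; rewrite -e; exact: ahatP.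
(* A wrong stop is a crossing of the test of the winner i against astar. *)
pose F i := if i == astar then set0
  else [set w | exists t, crosses eps i astar (hist_at X A t w)].
have mF i : measurable (F i).
  by rewrite /F; case: ifP => // _; exact: measurable_crossing.
apply: le_trans (prob_cover (I := 'I_K) (F := F) P _ mF _) _.
- by apply: bigcupT_measurable => t; exact: measurable_hist.
- move=> w [t _ [st _ nmax]].
  have [h0 [i ibeats]] := st.
  have ne : i != astar.
    apply/eqP => ia; apply: nmax; rewrite -ia => k.
    have [->//|ki] := eqVneq k i.
    have [_ _] := glrseq_gt0 (le_lt_trans (beta_ge0 _ st) (ibeats k ki)).
    exact: ltW.
  exists i => //; rewrite /F (negbTE ne); exists t; split=> //.
  by rewrite -betaE; apply: ibeats; rewrite eq_sym.
- apply: le_trans (_ : \sum_(i < K | i != astar) eps%:E <= _)%E.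
    rewrite [leRHS]big_mkcond; apply: lee_sum => i _; rewrite /F.
    case: eqVneq => [_|ne] /=; first by rewrite measure0.
    by apply: (glr_crossing hA model mu01 eps01 ne); exact: mumax.
  rewrite sumEFin lee_fin sumr_const cardC1 card_ord -mulr_natr.
  rewrite -subn1 natrB ?(ltnW hK)// /eps divfK//.
  by rewrite gt_eqF//; lra.
Qed.
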